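(* Let $E_1,E_2,E_3$ be pairwise disjoint finite sets, let $\mathscr{C}_1$ be a matroid on $E_1\sqcup E_2$ and let $\mathscr{C}_2$ be a matroid on $E_2\sqcup E_3$. Then the composition $\mathscr{C}_{2*}\circ\mathscr{C}_{1*}:\mathrm{Mat}(E_1)\to\mathrm{Mat}(E_3)$ is equal to the matroid correspondence $\mathscr{C}_*$, where $\mathscr{C}$ is the matroid on $E_1\sqcup E_3$ given by $$\mathscr{C}=\big((\mathscr{C}_1\oplus \mathbf{B}_{E_3})\wedge(\mathbf{B}_{E_1}\oplus \mathscr{C}_2)\big)\setminus E_2.$$ In particular, a composition of matroid correspondences is a matroid correspondence.
   Context: All matroids are on finite ground sets. $\mathrm{Mat}(E)$ denotes the poset category of matroids on $E$, whose morphisms are matroid quotients ($N$ is a quotient of $M$ if every flat of $N$ is a flat of $M$). For matroids $M,N$ on the same ground set $E$, the intersection $M\wedge N$ is the matroid on $E$ whose bases are the inclusion-minimal sets among $\{B\cap B' : B \text{ a basis of } M,\ B'\text{ a basis of } N\}$ (equivalently, the dual of the matroid union of the duals of $M$ and $N$). $\mathbf{B}_{E}$ denotes the Boolean matroid on $E$ (its only basis is $E$), $\oplus$ denotes direct sum and $\setminus$ denotes deletion. For disjoint finite sets $F_1,F_2$ and a matroid $\mathscr{D}$ on $F_1\sqcup F_2$, the matroid correspondence $\mathscr{D}_*:\mathrm{Mat}(F_1)\to\mathrm{Mat}(F_2)$ is the functor $M\mapsto \big((M\oplus \mathbf{B}_{F_2})\wedge \mathscr{D}\big)\setminus F_1$.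 *)

(* Defs.v *)
From HB Require Import structures.
From mathcomp Require Import all_boot all_order.
From mathcomp Require Import zify.

Set Implicit Arguments.
Unset Strict Implicit.
Unset Printing Implicit Defensive.

Import Order.Theory.

Section MatroidDef.
Variable E : finType.

Definition basis_axiom (Bs : {set {set E}}) : bool :=
  (Bs != set0) &&
  [forall B1 in Bs, forall B2 in Bs, forall x in B1 :\: B2,
     exists y in B2 :\: B1, (y |: B1 :\ x) \in Bs].

Record matroid := Matroid { bases : {set {set E}}; _ : basis_axiom bases }.

HB.instance Definition _ := [isSub for bases].
HB.instance Definition _ := [Finite of matroid by <:].

Implicit Types M N : matroid.

(* The rank of A is the largest size of an independent subset A :&: B of A *)
Definition rank M (A : {set E}) : nat := \max_(B in bases M) #|A :&: B|.

Definition flat M (F : {set E}) : bool :=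
  [forall x in ~: F, rank M F < rank M (x |: F)].

Definition quotient N M : bool := [forall F : {set E}, flat N F ==> flat M F].

Definition indep M (I : {set E}) : bool := [exists B in bases M, I \subset B].

End MatroidDef.

Section Basics.
Variable E : finType.
Implicit Types (M N : matroid E) (A B I J X Y T : {set E}).

Lemma basis_axiomP (Bs : {set {set E}}) :
  reflect ((exists B, B \in Bs) /\
           (forall B1 B2 x, B1 \in Bs -> B2 \in Bs -> x \in B1 -> x \notin B2 ->
              exists y, [/\ y \in B2, y \notin B1 & (y |: B1 :\ x) \in Bs]))
          (basis_axiom Bs).
Proof.
apply: (iffP andP) => [[/set0Pn ex /forall_inP exch]|[ex exch]]; split => //.
- move=> B1 B2 x B1in B2in xB1 xB2.
  have /forall_inP/(_ x) := forall_inP (exch _ B1in) _ B2in.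
  rewrite inE xB1 xB2 => /(_ isT) /exists_inP [y]; rewrite inE => /andP [? ?] ?.
  by exists y.
- exact/set0Pn.
- apply/forall_inP => B1 B1in; apply/forall_inP => B2 B2in.
  apply/forall_inP => x; rewrite inE => /andP [xB2 xB1].
  have [y [? ? ?]] := exch _ _ _ B1in B2in xB1 xB2.
  by apply/exists_inP; exists y => //; rewrite inE; apply/andP.
Qed.

Lemma ex_basis M : exists B, B \in bases M.
Proof. by case: M => Bs /= /basis_axiomP []. Qed.

Lemma basis_exchange M B1 B2 x :
  B1 \in bases M -> B2 \in bases M -> x \in B1 -> x \notin B2 ->
  exists y, [/\ y \in B2, y \notin B1 & (y |: B1 :\ x) \in bases M].
Proof. by case: M => Bs /= /basis_axiomP [_]; apply. Qed.

Lemma card_swap B x y : x \in B -> y \notin B -> #|y |: B :\ x| = #|B|.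
Proof.
move=> xB yB; rewrite cardsU1 !inE (negbTE yB) andbF /=.
by rewrite [in RHS](cardsD1 x) xB.
Qed.

Lemma card_bases M B1 B2 : B1 \in bases M -> B2 \in bases M -> #|B1| = #|B2|.
Proof.
move: {2}#|B1 :\: B2| (leqnn #|B1 :\: B2|) => n.
elim: n B1 B2 => [|n IHn] B1 B2 le_n B1in B2in.
  have sB12 : B1 \subset B2.
    by rewrite -setD_eq0 -cards_eq0; move: le_n; rewrite leqn0.
  have [sB21|] := boolP (B2 \subset B1).
    by congr #|pred_of_set _|; apply/eqP; rewrite eqEsubset sB12.
  case/subsetPn => x xB2 xB1.
  have [y [yB1 yB2 _]] := basis_exchange B2in B1in xB2 xB1.
  by rewrite (subsetP sB12) in yB2.
have [D0|/set0Pn [x]] := eqVneq (B1 :\: B2) set0.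
  by apply: IHn => //; rewrite D0 cards0.
rewrite inE => /andP [xB2 xB1].
have [y [yB2 yB1 B3in]] := basis_exchange B1in B2in xB1 xB2.
rewrite -(card_swap xB1 yB1); apply: IHn => //.
suff : (y |: B1 :\ x) :\: B2 \subset (B1 :\: B2) :\ x.
  move/subset_leq_card/leq_trans; apply.
  by move: le_n; rewrite (cardsD1 x) !inE xB1 xB2.
apply/subsetP => z; rewrite !inE => /andP [zB2 /orP [/eqP zy|/andP [-> ->]]].
  by rewrite zy yB2 in zB2.
by rewrite zB2.
Qed.

Lemma basis_indep M B : B \in bases M -> indep M B.
Proof. by move=> Bin; apply/exists_inP; exists B. Qed.

Lemma indepS M I J : I \subset J -> indep M J -> indep M I.
Proof.
move=> sIJ /exists_inP [B Bin sJB].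
by apply/exists_inP; exists B => //; apply: subset_trans sJB.
Qed.

Lemma indep0 M : indep M set0.
Proof.
by have [B Bin] := ex_basis M; apply: indepS (basis_indep Bin); apply: sub0set.
Qed.

Lemma indep_aug M I J : indep M I -> indep M J -> #|I| < #|J| ->
  exists2 y, y \in J :\: I & indep M (y |: I).
Proof.
move=> /exists_inP [B1 B1in sI] /exists_inP [B2 B2in sJ] ltIJ.
have [n] := ubnP (#|E| - #|B1 :&: B2|).
elim: n B1 B2 B1in sI B2in sJ => // n IHn B1 B2 B1in sI B2in sJ len.
have [/existsP [y /and3P [yJ yI yB1]]|/existsPn noaug] :=
  boolP [exists y, [&& y \in J, y \notin I & y \in B1]].
  exists y; first by rewrite inE yI.
  by apply: indepS (basis_indep B1in); rewrite subUset sub1set yB1.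
have [/existsP [x /and3P [xB1 xI xB2]]|/existsPn no1] :=
  boolP [exists x, [&& x \in B1, x \notin I & x \notin B2]].
  have [y [yB2 yB1 B3in]] := basis_exchange B1in B2in xB1 xB2.
  apply: (IHn (y |: B1 :\ x) B2) => //.
    apply/subsetP => z zI; rewrite !inE (subsetP sI) // andbT.
    by case: (eqVneq z x) => [zx|]; [rewrite -zx zI in xI | rewrite orbT].
  suff : #|B1 :&: B2| < #|(y |: B1 :\ x) :&: B2|.
    have le : #|(y |: B1 :\ x) :&: B2| <= #|E| by exact: max_card.
    by move: (#|E|) le len => e; clear; lia.
  apply: proper_card; apply/properP; split.
    apply/subsetP => z; rewrite !inE => /andP [-> zB2]; rewrite zB2 !andbT.
    by case: (eqVneq z x) => [zx|]; [rewrite -zx zB2 in xB2 | rewrite orbT].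
  by exists y; rewrite !inE ?eqxx ?yB2 // (negbTE yB1).
have [/existsP [x /and3P [xB2 xJ xB1]]|/existsPn no2] :=
  boolP [exists x, [&& x \in B2, x \notin J & x \notin B1]].
  have [y [yB1 yB2 B3in]] := basis_exchange B2in B1in xB2 xB1.
  apply: (IHn B1 (y |: B2 :\ x)) => //.
    apply/subsetP => z zJ; rewrite !inE (subsetP sJ) // andbT.
    by case: (eqVneq z x) => [zx|]; [rewrite -zx zJ in xJ | rewrite orbT].
  suff : #|B1 :&: B2| < #|B1 :&: (y |: B2 :\ x)|.
    have le : #|B1 :&: (y |: B2 :\ x)| <= #|E| by exact: max_card.
    by move: (#|E|) le len => e; clear; lia.
  apply: proper_card; apply/properP; split.
    apply/subsetP => z; rewrite !inE => /andP [zB1 ->]; rewrite zB1 andbT.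
    by case: (eqVneq z x) => [zx|]; [rewrite -zx zB1 in xB1 | rewrite orbT].
  by exists y; rewrite !inE ?eqxx ?yB1 // (negbTE yB2).
exfalso.
have := cardsID B2 B1; have := cardsID B1 B2; have := card_bases B1in B2in.
rewrite [B2 :&: B1]setIC; move=> e1 e2 e3.
have s1 : B1 :\: B2 \subset I :\: J.
  apply/subsetP => z; rewrite !inE => /andP [zB2 zB1].
  have := no1 z; rewrite zB1 zB2 andbT negbK => ->; rewrite andbT.
  by apply: contra zB2; apply: (subsetP sJ).
have s2 : J :\: I \subset B2 :\: B1.
  apply/subsetP => z; rewrite !inE => /andP [zI zJ].
  rewrite (subsetP sJ) // andbT; apply/negP => zB1.
  by have := noaug z; rewrite zJ zI zB1.
have := subset_leq_card s1; have := subset_leq_card s2.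
have := cardsID J I; have := cardsID I J; rewrite [J :&: I]setIC; lia.
Qed.

Section IndepSystem.
Variable P : pred {set E}.
Hypothesis P0 : P set0.
Hypothesis PS : forall I J, I \subset J -> P J -> P I.
Hypothesis Paug : forall I J, P I -> P J -> #|I| < #|J| ->
  exists2 y, y \in J :\: I & P (y |: I).

Lemma indep_system_basis_axiom : basis_axiom [set X | maxset P X].
Proof.
have maxcard B I : maxset P B -> P I -> #|I| <= #|B|.
  move=> /maxsetP [PB maxB] PI; rewrite leqNgt; apply/negP => lt.
  have [y] := Paug PB PI lt; rewrite inE => /andP [yB _] PyB.
  by have := maxB _ PyB (subsetUr _ _) => yBB; rewrite -yBB !inE eqxx in yB.
apply/basis_axiomP; split.
  by have [B maxB _] := maxset_exists P0; exists B; rewrite inE.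
move=> B1 B2 x; rewrite !inE => m1 m2 xB1 xB2.
have P1 := maxsetp m1; have P2 := maxsetp m2.
have P1x : P (B1 :\ x) by apply: PS P1; apply: subD1set.
have ltB : #|B1 :\ x| < #|B2|.
  by have := maxcard _ _ m2 P1; rewrite (cardsD1 x B1) xB1.
have [y] := Paug P1x P2 ltB; rewrite !inE => /andP [yB1 yB2] Py.
have yx : y != x by apply: contraNneq xB2 => <-.
rewrite yx /= in yB1; exists y; split => //; rewrite inE.
apply/maxsetP; split => // C PC sC; apply/eqP; rewrite eq_sym eqEcard sC /=.
by rewrite card_swap //; apply: maxcard.
Qed.

End IndepSystem.

Lemma maxset_downclosure (S : {set {set E}}) X :
  maxset (fun Z => Z \in S) X = maxset (fun Z => [exists Y in S, Z \subset Y]) X.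
Proof.
apply/maxsetP/maxsetP => [[XS maxX]|[/exists_inP [Y YS sXY] maxX]]; split.
- by apply/exists_inP; exists X.
- move=> B /exists_inP [Y YS sBY] sXB; apply/eqP.
  by rewrite eqEsubset sXB andbT -(maxX Y YS) // (subset_trans sXB).
- suff <- : Y = X by [].
  by apply: maxX => //; apply/exists_inP; exists Y.
- by move=> B BS sXB; apply: maxX => //; apply/exists_inP; exists B.
Qed.

Lemma indep_maxset (P : pred {set E}) M X :
  (forall I J, I \subset J -> P J -> P I) ->
  bases M = [set B | maxset P B] -> indep M X = P X.
Proof.
move=> PS bM; apply/exists_inP/idP => [[B]|PX].
  by rewrite bM inE => /maxsetp PB sXB; apply: PS PB.
by have [B mB sXB] := maxset_exists PX; exists B => //; rewrite bM inE.
Qed.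

Lemma rank_ge M I A : indep M I -> I \subset A -> #|I| <= rank M A.
Proof.
move=> /exists_inP [B Bin sIB] sIA; rewrite /rank.
apply: (bigop.bigmax_sup B) => //.
by apply: subset_leq_card; rewrite subsetI sIA.
Qed.

Lemma rank_witness M A :
  exists I, [/\ indep M I, I \subset A & #|I| = rank M A].
Proof.
have [B0 B0in] := ex_basis M.
have [|B Bin e] := @eq_bigmax_cond _ (mem (bases M)) (fun B => #|A :&: B|).
  by rewrite card_gt0; apply/set0Pn; exists B0.
exists (A :&: B); split; rewrite ?subsetIl //.
by apply: indepS (basis_indep Bin); apply: subsetIr.
Qed.

Lemma rankP M A n : reflect
  (exists I, [/\ indep M I, I \subset A & n <= #|I|]) (n <= rank M A).
Proof.
apply: (iffP idP) => [le|[I [iI sI le]]]; last exact: leq_trans (rank_ge iI sI).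
by have [I [iI sI e]] := rank_witness M A; exists I; rewrite e.
Qed.

Lemma rank_ext M I A : indep M I -> I \subset A ->
  exists J, [/\ indep M J, I \subset J, J \subset A & #|J| = rank M A].
Proof.
move=> iI sIA.
pose P X := indep M X && (X \subset A).
have /maxset_exists [J /maxsetP [/andP [iJ sJA] maxJ] sIJ] : P I by apply/andP.
exists J; split => //; apply/eqP; rewrite eqn_leq rank_ge //= leqNgt.
apply/negP; have [K [iK sKA <-]] := rank_witness M A => lt.
have [y] := indep_aug iJ iK lt; rewrite inE => /andP [yJ yK] iyJ.
suff e : y |: J = J by rewrite -e !inE eqxx in yJ.
by apply: maxJ; rewrite ?subsetUr // /P iyJ subUset sub1set (subsetP sKA).
Qed.

Lemma rankS M A B : A \subset B -> rank M A <= rank M B.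
Proof.
move=> sAB; have [I [iI sIA <-]] := rank_witness M A.
by apply: rank_ge iI _; apply: subset_trans sAB.
Qed.

Lemma rank0 M : rank M set0 = 0.
Proof.
have [I [_ sI0 <-]] := rank_witness M set0.
by move: sI0; rewrite subset0 => /eqP ->; rewrite cards0.
Qed.

Lemma rank_basis M B : B \in bases M -> rank M [set: E] = #|B|.
Proof.
move=> Bin; apply/eqP; rewrite eqn_leq rank_ge ?subsetT ?basis_indep // andbT.
apply/bigmax_leqP => B' B'in; rewrite (card_bases Bin B'in).
exact/subset_leq_card/subsetIr.
Qed.

Lemma basisE M B : (B \in bases M) = indep M B && (#|B| == rank M [set: E]).
Proof.
apply/idP/andP => [Bin|[/exists_inP [B' B'in sBB'] /eqP e]].
  by rewrite basis_indep // (rank_basis Bin).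
suff -> : B = B' by [].
by apply/eqP; rewrite eqEcard sBB' e (rank_basis B'in) /=.
Qed.

Lemma indepE M I : indep M I = (rank M I == #|I|).
Proof.
apply/idP/eqP => [iI|e].
  apply/eqP; rewrite eqn_leq rank_ge // andbT.
  by have [J [_ sJI <-]] := rank_witness M I; apply: subset_leq_card.
have [J [iJ sJI eJ]] := rank_witness M I.
suff <- : J = I by [].
by apply/eqP; rewrite eqEcard sJI eJ e /=.
Qed.

Lemma rank_card M A : rank M A <= #|A|.
Proof.
by have [I [_ sI <-]] := rank_witness M A; apply: subset_leq_card.
Qed.

Lemma card_setU1_le (x : E) A : #|x |: A| <= #|A|.+1.
Proof. by rewrite cardsU1; case: (x \notin A). Qed.

Lemma rankU1 M A x : rank M (x |: A) <= (rank M A).+1.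
Proof.
have [I [iI sI <-]] := rank_witness M (x |: A).
rewrite (cardsD1 x I).
suff h : #|I :\ x| <= rank M A by move: h; case: (x \in I) => /=; lia.
apply: rank_ge; first by apply: indepS iI; apply: subD1set.
by rewrite subDset.
Qed.

Lemma rank_submod M A B :
  rank M (A :|: B) + rank M (A :&: B) <= rank M A + rank M B.
Proof.
have [I [iI sI <-]] := rank_witness M (A :&: B).
have sIU : I \subset A :|: B by apply: subset_trans sI _; rewrite subIset // subsetUl.
have [J [iJ sIJ sJ <-]] := rank_ext iI sIU.
have hA : #|J :&: A| <= rank M A.
  by apply: rank_ge; rewrite ?subsetIr //; apply: indepS iJ; apply: subsetIl.
have hB : #|J :&: B| <= rank M B.
  by apply: rank_ge; rewrite ?subsetIr //; apply: indepS iJ; apply: subsetIl.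
have h : #|I| <= #|(J :&: A) :&: (J :&: B)|.
  by apply: subset_leq_card; rewrite setIACA setIid subsetI sIJ.
have := cardsUI (J :&: A) (J :&: B).
rewrite -setIUr (setIidPl sJ); lia.
Qed.

Lemma rank_ext_eq M N : (forall A, rank M A = rank N A) -> M = N.
Proof.
move=> e; apply: val_inj; apply/setP => B.
by rewrite /= !basisE !indepE !e.
Qed.

End Basics.

Section QuotientRank.
Variable E : finType.
Implicit Types (M N : matroid E) (A B F S T : {set E}) (x y : E).

Lemma rank_closed M A F x : A \subset F ->
  rank M (x |: A) = rank M A -> rank M (x |: F) = rank M F.
Proof.
move=> sAF e; apply/eqP.
rewrite eqn_leq [X in _ && X]rankS ?subsetUr // andbT.
have := rank_submod M (x |: A) F.
have -> : (x |: A) :|: F = x |: F by rewrite -setUA (setUidPr sAF).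
have : rank M A <= rank M ((x |: A) :&: F).
  by apply: rankS; rewrite subsetI subsetUr.
lia.
Qed.

Lemma rank_closedU M A T : A \subset T ->
  (forall y, y \in T -> rank M (y |: A) = rank M A) -> rank M T = rank M A.
Proof.
move=> sAT clT; apply/eqP; rewrite eqn_leq (rankS _ sAT) andbT.
have [I [iI sIA eI]] := rank_witness M A.
have [J [iJ sIJ sJT <-]] := rank_ext iI (subset_trans sIA sAT).
rewrite leqNgt -eI; apply/negP => lt.
have /subsetPn [y yJ yI] : ~~ (J \subset I).
  by apply: contraL lt => /subset_leq_card; rewrite -leqNgt.
have := rank_ge (M := M) (I := y |: I) (A := y |: A).
rewrite setUS // clT ?(subsetP sJT) // cardsU1 yI eI => h.
have : indep M (y |: I) by apply: indepS iJ; rewrite subUset sub1set yJ.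
by move/h => /(_ isT); rewrite add1n ltnn.
Qed.

Lemma quotientP N M : reflect
  (forall A x, rank M (x |: A) = rank M A -> rank N (x |: A) = rank N A)
  (quotient N M).
Proof.
apply: (iffP forallP) => [q A x eM|q F].
  pose F := [set y | rank N (y |: A) == rank N A].
  have sAF : A \subset F.
    apply/subsetP => y yA; rewrite inE; apply/eqP; congr (rank N _).
    by apply/setUidPr; rewrite sub1set.
  have rF : rank N F = rank N A.
    by apply: rank_closedU => // y; rewrite inE => /eqP.
  have fF : flat N F.
    apply/forall_inP => y; rewrite !inE => yF.
    rewrite ltn_neqAle rankS ?subsetUr // andbT eq_sym.
    apply: contra yF => /eqP e; apply/eqP/eqP.
    rewrite eqn_leq [_ <= rank N (y |: A)]rankS ?subsetUr // andbT -rF -e.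
    by apply: rankS; apply: setUS.
  have /forall_inP fM := implyP (q F) fF.
  apply/eqP; have [xF|xF] := boolP (x \in F); first by move: xF; rewrite inE.
  by have := fM x; rewrite inE xF (rank_closed sAF eM) ltnn => /(_ isT).
apply/implyP => /forall_inP fN; apply/forall_inP => x xF.
rewrite ltn_neqAle rankS ?subsetUr // andbT.
by apply/eqP => e; have := fN x xF; rewrite (q F x) ?ltnn.
Qed.

Lemma quotient_rank N M S T : quotient N M -> S \subset T ->
  rank N T + rank M S <= rank N S + rank M T.
Proof.
move=> /quotientP q sST.
have [n] := ubnP #|T :\: S|.
elim: n S sST => // n IHn S sST lt.
have [/eqP|/set0Pn [x]] := eqVneq (T :\: S) set0.
  by rewrite setD_eq0 => sTS; have -> : S = T by apply/eqP; rewrite eqEsubset sST.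
rewrite inE => /andP [xS xT].
have sxT : x |: S \subset T by rewrite subUset sub1set xT.
have ltx : #|T :\: (x |: S)| < n.
  rewrite setUC -setDDl; move: lt; rewrite (cardsD1 x (T :\: S)) inE xS xT; lia.
have := IHn _ sxT ltx; have := q S x; have := rankU1 M S x.
have := rankU1 N S x; have := rankS M (subsetUr [set x] S).
have := rankS N (subsetUr [set x] S).
lia.
Qed.

End QuotientRank.

Section Dual.
Variable E : finType.
Implicit Types (M N : matroid E) (A B : {set E}).

Lemma dual_basis_axiom M : basis_axiom [set ~: B | B in bases M].
Proof.
apply/basis_axiomP; split.
  by have [B Bin] := ex_basis M; exists (~: B); apply: imset_f.
move=> _ _ y /imsetP [B1 B1in ->] /imsetP [B2 B2in ->].
rewrite !inE negbK => yB1 yB2.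
have iI : indep M (y |: B1 :&: B2).
  by apply: indepS (basis_indep B2in); rewrite subUset sub1set yB2 subsetIr.
have sI : y |: B1 :&: B2 \subset y |: B1 by apply: setUS; apply: subsetIl.
have rE : rank M (y |: B1) = rank M [set: E].
  apply/eqP; rewrite eqn_leq rankS ?subsetT //= (rank_basis B1in).
  by apply: rank_ge (basis_indep B1in) _; apply: subsetUr.
have [B [iB sIB sB eB]] := rank_ext iI sI.
have Bin : B \in bases M by rewrite basisE iB eB rE eqxx.
have yB : y \in B by apply: (subsetP sIB); rewrite !inE eqxx.
have /subsetPn [z zB1 zB] : ~~ (B1 \subset B).
  apply/negP => sB1B; have := cardsU1 y B1; rewrite yB1 -(card_bases Bin B1in).
  have : #|y |: B1| <= #|B| by rewrite subset_leq_card // subUset sub1set yB.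
  by move=> /[swap] ->; rewrite ltnn.
have zy : z != y by apply: contraNneq zB => ->.
have eqB : B = (y |: B1) :\ z.
  apply/eqP; rewrite eqEcard; apply/andP; split.
    apply/subsetP => w wB; rewrite in_setD1 (subsetP sB) // andbT.
    by apply: contraNneq zB => <-.
  have := cardsD1 z (y |: B1); rewrite cardsU1 yB1 !inE zB1 orbT.
  by rewrite -(card_bases Bin B1in) => /addnI ->.
exists z; split; rewrite ?inE ?negbK ?zB1 //.
  apply: contra zB => zB2; apply: (subsetP sIB).
  by rewrite !inE zB1 zB2 orbT.
suff -> : z |: ~: B1 :\ y = ~: B by apply: imset_f.
rewrite eqB; apply/setP => w; rewrite !inE negb_and negbK negb_or.
by case: (eqVneq w z) => // _; case: (eqVneq w y).
Qed.

Definition mdual M : matroid E := Matroid (dual_basis_axiom M).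

Lemma bases_mdual M B : (B \in bases (mdual M)) = (~: B \in bases M).
Proof.
apply/imsetP/idP => [[B' B'in ->]|Bin]; first by rewrite setCK.
by exists (~: B); rewrite ?setCK.
Qed.

Lemma mdualK : involutive mdual.
Proof.
move=> M; apply: val_inj; apply/setP => B.
by rewrite -[LHS]/(B \in bases (mdual (mdual M))) !bases_mdual setCK.
Qed.

Lemma rank_max M A B : B \in bases M -> #|A :&: B| <= rank M A.
Proof.
move=> Bin; apply: rank_ge (subsetIl _ _).
by apply: indepS (basis_indep Bin); apply: subsetIr.
Qed.

Lemma rank_max_witness M A :
  exists2 B, B \in bases M & rank M A = #|A :&: B|.
Proof.
have [I [/exists_inP [B Bin sIB] sIA eI]] := rank_witness M A.
exists B => //; apply/eqP; rewrite eqn_leq rank_max // andbT -eI.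
by apply: subset_leq_card; rewrite subsetI sIA.
Qed.

Lemma rank_mdual M A :
  rank (mdual M) A + rank M [set: E] = #|A| + rank M (~: A).
Proof.
have key B : B \in bases M ->
    #|A :&: ~: B| + rank M [set: E] = #|A| + #|~: A :&: B|.
  move=> Bin; rewrite (rank_basis Bin) -setDE.
  have := cardsID B A; have := cardsID A B; rewrite setDE (setIC B) (setIC B).
  lia.
have [B1 B1in e1] := rank_max_witness (mdual M) A.
have [B2 B2in e2] := rank_max_witness M (~: A).
have B1in' : ~: B1 \in bases M by rewrite -bases_mdual.
have B2in' : ~: B2 \in bases (mdual M) by rewrite bases_mdual setCK.
have := key _ B1in'; have := key _ B2in; rewrite setCK.
have := rank_max A B2in'; have := rank_max (~: A) B1in'.
rewrite e1 e2; lia.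
Qed.

Lemma quotient_mdual N M : quotient N M -> quotient (mdual M) (mdual N).
Proof.
move=> /quotientP q; apply/quotientP => A x.
have [xA|xA] := boolP (x \in A); first by rewrite (setUidPr _) ?sub1set.
have e : ~: A = x |: ~: (x |: A).
  apply/setP => z; rewrite !inE negb_or.
  by case: (eqVneq z x) => // ->.
have := rank_mdual M A; have := rank_mdual M (x |: A).
have := rank_mdual N A; have := rank_mdual N (x |: A).
have := q (~: (x |: A)) x; rewrite -e cardsU1 xA.
have := rankU1 M (~: (x |: A)) x; rewrite -e.
have := rankS M (subsetUr [set x] (~: (x |: A))); rewrite -e.
have := rankS N (subsetUr [set x] (~: (x |: A))); rewrite -e.
move=> /=; lia.
Qed.

End Dual.

Section Union.
Variable E : finType.
Implicit Types (M N D : matroid E) (A B I J X Y S T : {set E}).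

Let P M N X :=
  [exists Y in [set B :|: B' | B in bases M, B' in bases N], X \subset Y].

Let unionP M N X :
  reflect (exists I J, [/\ indep M I, indep N J & X = I :|: J]) (P M N X).
Proof.
apply: (iffP exists_inP) => [[_ /imset2P [B B' Bin B'in ->] sX]|].
  exists (X :&: B), (X :&: B'); split.
  - by apply: indepS (basis_indep Bin); apply: subsetIr.
  - by apply: indepS (basis_indep B'in); apply: subsetIr.
  - by rewrite -setIUr (setIidPl sX).
move=> [I [J [/exists_inP [B Bin sB] /exists_inP [B' B'in sB'] ->]]].
by exists (B :|: B'); [exact: imset2_f | exact: setUSS].
Qed.

Lemma union_aug M N I1 J1 I2 J2 :
  indep M I1 -> indep N J1 -> [disjoint I1 & J1] ->
  indep M I2 -> indep N J2 -> [disjoint I2 & J2] ->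
  #|I1 :|: J1| < #|I2 :|: J2| ->
  exists2 y, y \in (I2 :|: J2) :\: (I1 :|: J1) &
    exists I J, [/\ indep M I, indep N J & y |: (I1 :|: J1) = I :|: J].
Proof.
have [n] := ubnP (#|I2| + #|J2| - (#|I1 :&: I2| + #|J1 :&: J2|)).
elim: n M N I1 J1 I2 J2 => // n IHn M N I1 J1 I2 J2 len i1 j1 d1 i2 j2 d2 lt.
wlog ltI : M N I1 J1 I2 J2 len i1 j1 d1 i2 j2 d2 lt / #|I1| < #|I2|.
  move=> W; have [ltI|geI] := ltnP #|I1| #|I2|; first exact: (W M N I1 J1 I2 J2).
  have ltJ : #|J1| < #|J2|.
    have := leq_card_setU I1 J1; have := leq_card_setU I2 J2.
    rewrite d1 d2 => -[_ /eqP e2] [_ /eqP e1].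
    move: lt; rewrite e1 e2; lia.
  have len' : #|J2| + #|I2| - (#|J1 :&: J2| + #|I1 :&: I2|) < n.+1.
    by rewrite [#|J2| + _]addnC [#|J1 :&: J2| + _]addnC.
  have lt' : #|J1 :|: I1| < #|J2 :|: I2| by rewrite [J1 :|: _]setUC [J2 :|: _]setUC.
  have d1' : [disjoint J1 & I1] by rewrite disjoint_sym.
  have d2' : [disjoint J2 & I2] by rewrite disjoint_sym.
  have [y yin [J [I [jJ iI e]]]] := W N M J1 I1 J2 I2 len' j1 i1 d1' j2 i2 d2' lt' ltJ.
  exists y; first by rewrite [I1 :|: _]setUC [I2 :|: _]setUC.
  by exists I, J; split; rewrite // [I1 :|: _]setUC e setUC.
have [y] := indep_aug i1 i2 ltI; rewrite inE => /andP [yI1 yI2] iy.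
have yJ2 : y \notin J2 by move/pred0P/(_ y): d2; rewrite /= yI2 /= => ->.
have [yJ1|yJ1] := boolP (y \in J1); last first.
  exists y; first by rewrite !inE (negbTE yI1) (negbTE yJ1) yI2.
  by exists (y |: I1), J1; rewrite setUA.
have eU : (y |: I1) :|: (J1 :\ y) = I1 :|: J1.
  apply/setP => z; rewrite !inE; case: (eqVneq z y) => //= ->.
  by rewrite yJ1 orbT.
have := IHn M N (y |: I1) (J1 :\ y) I2 J2; rewrite eU; apply => //.
- have -> : (J1 :\ y) :&: J2 = J1 :&: J2.
    apply/setP => z; rewrite !inE; case: (eqVneq z y) => //= ->.
    by rewrite (negbTE yJ2) andbF.
  have -> : (y |: I1) :&: I2 = y |: (I1 :&: I2).
    by rewrite setIUl; congr (_ :|: _); apply/setIidPl; rewrite sub1set.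
  rewrite cardsU1 inE (negbTE yI1) /=.
  have : #|y |: (I1 :&: I2)| <= #|I2|.
    by apply: subset_leq_card; rewrite subUset sub1set yI2 subsetIr.
  rewrite cardsU1 inE (negbTE yI1) /=.
  have : #|J1 :&: J2| <= #|J2| by apply/subset_leq_card/subsetIr.
  move: len; clear; lia.
- by apply: indepS j1; apply: subD1set.
- apply/pred0P => z /=; rewrite !inE; case: (eqVneq z y) => //= _.
  exact: (pred0P d1 z).
Qed.

Lemma union_split M N X :
  reflect (exists I J, [/\ indep M I, indep N J, [disjoint I & J] & X = I :|: J])
    (P M N X).
Proof.
apply: (iffP (unionP M N X)) => -[I [J [iI jJ]]]; last by exists I, J.
move=> e; exists I, (J :\: I); split => //.
- by apply: indepS jJ; apply: subsetDl.
- by rewrite disjoint_sym disjoints_subset subsetDr.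
- by rewrite e; apply/setP => z; rewrite !inE; case: (z \in I).
Qed.

Lemma munion_basis_axiom M N : basis_axiom
  [set X | maxset (fun X => X \in [set B :|: B' | B in bases M, B' in bases N]) X].
Proof.
have -> : [set X | maxset
    (fun X => X \in [set B :|: B' | B in bases M, B' in bases N]) X] =
    [set X | maxset (P M N) X].
  by apply/setP => X; rewrite !inE maxset_downclosure.
apply: indep_system_basis_axiom.
- by apply/unionP; exists set0, set0; rewrite !indep0 setU0.
- move=> X Y sXY /exists_inP [Z Zin sYZ].
  by apply/exists_inP; exists Z => //; apply: subset_trans sYZ.
- move=> _ _ /union_split [I1 [J1 [i1 j1 d1 ->]]] /union_split
    [I2 [J2 [i2 j2 d2 ->]]] lt.
  have [y yin ex] := union_aug i1 j1 d1 i2 j2 d2 lt.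
  by exists y => //; apply/unionP.
Qed.

Definition munion M N : matroid E := Matroid (munion_basis_axiom M N).

Lemma indep_munion M N X :
  reflect (exists I J, [/\ indep M I, indep N J & X = I :|: J])
    (indep (munion M N) X).
Proof.
suff -> : indep (munion M N) X = P M N X by exact: unionP.
apply: indep_maxset.
  move=> Y Z sYZ /exists_inP [W Win sZW].
  by apply/exists_inP; exists W => //; apply: subset_trans sZW.
by apply/setP => Y; rewrite !inE maxset_downclosure.
Qed.

Lemma munionC M N : munion M N = munion N M.
Proof.
apply: val_inj; rewrite /=; apply/setP => X; rewrite !inE; apply: maxset_eq => Y.
by apply/imset2P/imset2P => -[B B' ? ? ->]; exists B' B => //; rewrite setUC.
Qed.

Lemma rank_munion_le M N A T :
  rank (munion M N) A <= rank M T + rank N T + #|A :\: T|.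
Proof.
have [X [/indep_munion [I [J [iI jJ ->]]] sX <-]] := rank_witness (munion M N) A.
have hI : #|I :&: T| <= rank M T.
  by apply: rank_ge (subsetIr _ _); apply: indepS iI; apply: subsetIl.
have hJ : #|J :&: T| <= rank N T.
  by apply: rank_ge (subsetIr _ _); apply: indepS jJ; apply: subsetIl.
rewrite -(cardsID T (I :|: J)) setIUl.
have : #|(I :|: J) :\: T| <= #|A :\: T| by apply/subset_leq_card/setSD.
have := (leq_card_setU (I :&: T) (J :&: T)).1; lia.
Qed.

(* Common elements of a best pair of bases lie in every basis of the union *)
Lemma munion_overlap M N A I1 J1 I2 J2 :
  indep M I1 -> I1 \subset A -> #|I1| = rank M A ->
  indep N J1 -> J1 \subset A -> #|J1| = rank N A ->
  #|I1 :|: J1| = rank (munion M N) A ->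
  indep M I2 -> I2 \subset A -> #|I2| = rank M A ->
  indep N J2 -> J2 \subset A -> #|J2| = rank N A ->
  #|I2 :|: J2| = rank (munion M N) A ->
  I1 :&: J1 \subset I2 :|: J2.
Proof.
move=> i1 si1 ci1 j1 sj1 cj1 c1.
have [n] := ubnP (#|I1| + #|J1| - (#|I2 :&: I1| + #|J2 :&: J1|)).
elim: n M N I1 J1 I2 J2 i1 si1 ci1 j1 sj1 cj1 c1 =>
  // n IHn M N I1 J1 I2 J2 i1 si1 ci1 j1 sj1 cj1 c1 len i2 si2 ci2 j2 sj2 cj2 c2.
have eO : #|I2 :&: J2| = #|I1 :&: J1|.
  have := cardsUI I1 J1; have := cardsUI I2 J2.
  by rewrite c1 c2 ci1 ci2 cj1 cj2 => <- /addnI.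
have [sO|/subsetPn [y]] := boolP (I2 :&: J2 \subset I1 :&: J1).
  have /eqP <- : I2 :&: J2 == I1 :&: J1 by rewrite eqEcard sO eO /=.
  by rewrite subIset // subsetUl.
rewrite !inE negb_and => /andP [yI2 yJ2] yn.
wlog yI1 : M N I1 J1 I2 J2 i1 si1 ci1 j1 sj1 cj1 c1 len i2 si2 ci2 j2 sj2 cj2
    c2 yI2 yJ2 yn eO / y \notin I1.
  move=> W; case/orP: (yn) => [yI1|yJ1].
    exact: (W M N I1 J1 I2 J2).
  rewrite setIC [I2 :|: _]setUC; apply: (W N M) => //.
  - by rewrite setUC munionC.
  - by move: len; rewrite [#|I1| + _]addnC [#|I2 :&: I1| + _]addnC.
  - by rewrite setUC munionC.
  - by rewrite orbC.
  - by rewrite setIC eO setIC.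
have i2y : indep M (I2 :\ y) by apply: indepS i2; apply: subD1set.
have lt : #|I2 :\ y| < #|I1| by rewrite ci1 -ci2 (cardsD1 y I2) yI2.
have [z] := indep_aug i2y i1 lt; rewrite !inE => /andP [zI2 zI1] iz.
have zy : z != y by apply: contraNneq yI1 => <-.
rewrite zy /= in zI2.
have cz : #|z |: I2 :\ y| = #|I2| by apply: card_swap.
have eU : (z |: I2 :\ y) :|: J2 = z |: (I2 :|: J2).
  apply/setP => w; rewrite !inE; case: (eqVneq w y) => [->|_] /=.
    by rewrite yJ2 !orbT.
  by rewrite orbA.
have sz : z |: I2 :\ y \subset A.
  rewrite subUset sub1set (subsetP si1) //=.
  by apply: subset_trans si2; apply: subD1set.
have zin : z \in I2 :|: J2.
  apply: contraT => zn; have := cardsU1 z (I2 :|: J2); rewrite zn c2 -eU => e.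
  have : #|(z |: I2 :\ y) :|: J2| <= rank (munion M N) A.
    apply: rank_ge; last by rewrite subUset sz.
    by apply/indep_munion; exists (z |: I2 :\ y), J2.
  by rewrite e add1n ltnn.
have eU' : (z |: I2 :\ y) :|: J2 = I2 :|: J2.
  by rewrite eU; apply/setUidPr; rewrite sub1set.
rewrite -eU'; apply: (IHn M N) => //; rewrite ?cz ?eU' //.
have -> : (z |: I2 :\ y) :&: I1 = z |: (I2 :&: I1).
  apply/setP => w; rewrite !inE; case: (eqVneq w z) => [->|_] /=; first by rewrite zI1.
  by case: (eqVneq w y) => [->|_] //=; rewrite (negbTE yI1) andbF.
rewrite cardsU1 inE (negbTE zI2) /=.
have : #|z |: (I2 :&: I1)| <= #|I1|.
  by apply: subset_leq_card; rewrite subUset sub1set zI1 subsetIr.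
rewrite cardsU1 inE (negbTE zI2) /=.
have : #|J2 :&: J1| <= #|J1| by apply/subset_leq_card/subsetIr.
move: len; clear; lia.
Qed.

Lemma munion_cover M N A B :
  indep (munion M N) B -> B \subset A -> #|B| = rank (munion M N) A ->
  exists I J, [/\ indep M I, I \subset A & #|I| = rank M A] /\
    [/\ indep N J, J \subset A, #|J| = rank N A & I :|: J = B].
Proof.
move=> /indep_munion [I0 [J0 [i0 j0 ->]]]; rewrite subUset => /andP [si sj] c.
have [I [iI sI sIA cI]] := rank_ext i0 si.
have [J [jJ sJ sJA cJ]] := rank_ext j0 sj.
exists I, J; split; split => //; apply/esym/eqP.
rewrite eqEcard setUSS //= c; apply: rank_ge; last by rewrite subUset sIA.
by apply/indep_munion; exists I, J.
Qed.

Lemma rank_munion_witness M N A :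
  exists2 T : {set E}, T \subset A &
    rank (munion M N) A = rank M T + rank N T + #|A :\: T|.
Proof.
set U := munion M N.
pose isb B := [&& indep U B, B \subset A & #|B| == rank U A].
pose T := [set x in A | [exists B, isb B && (x \notin B)]].
have sTA : T \subset A by apply/subsetP => x; rewrite inE => /andP [].
have sK B : isb B -> A :\: T \subset B.
  move=> bB; apply/subsetP => x; rewrite !inE negb_and => /andP [/orP [/negbTE ->|]] //.
  by move=> /existsPn /(_ B); rewrite bB /= negbK.
have cB B : isb B -> #|B| = #|B :&: T| + #|A :\: T|.
  move=> bB; rewrite -(cardsID T B); congr (_ + _).
  suff -> : B :\: T = A :\: T by [].
  apply/eqP; rewrite eqEsubset; case/and3P: (bB) => _ sBA _.
  rewrite (setSD _ sBA) /= subsetD (sK B bB) /=.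
  by rewrite disjoints_subset subsetDr.
have [J [iJ sJT cJ]] := rank_witness U T.
have [B [iB sJB sBA cBA]] := rank_ext iJ (subset_trans sJT sTA).
have bB : isb B by rewrite /isb iB sBA cBA eqxx.
have rUT : rank U A = rank U T + #|A :\: T|.
  rewrite -cBA (cB _ bB); congr (_ + _); apply/eqP; rewrite eqn_leq; apply/andP; split.
    by apply: rank_ge (subsetIr _ _); apply: indepS iB; apply: subsetIl.
  by rewrite -cJ; apply: subset_leq_card; rewrite subsetI sJB.
exists T => //; rewrite rUT; congr (_ + _).
have [I1 [J1 [[i1 s1 c1] [j1 t1 d1 e1]]]] := munion_cover iJ sJT cJ.
have := cardsUI I1 J1; rewrite e1 cJ c1 d1.
suff -> : I1 :&: J1 = set0 by rewrite cards0 addn0.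
apply/eqP; rewrite -subset0; apply/subsetP => z zO.
have zT : z \in T by case/setIP: zO => /(subsetP s1).
have := zT; rewrite inE => /andP [zA /existsP [B' /andP [bB' zB']]].
have iB' : indep U (B' :&: T).
  by case/and3P: bB' => iB' _ _; apply: indepS iB'; apply: subsetIl.
have cB' : #|B' :&: T| = rank U T.
  have := cB _ bB'; case/and3P: (bB') => _ _ /eqP ->.
  by rewrite rUT => /addIn ->.
have [I2 [J2 [[i2 s2 c2] [j2 t2 d2 e2]]]] := munion_cover iB' (subsetIr _ _) cB'.
have := munion_overlap i1 s1 c1 j1 t1 d1 _ i2 s2 c2 j2 t2 d2.
rewrite e1 e2 => /(_ cJ cB') /subsetP /(_ z zO).
by rewrite inE (negbTE zB').
Qed.

Lemma quotient_munion N M D : quotient N M -> quotient (munion N D) (munion M D).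
Proof.
move=> q; apply/quotientP => A x eM.
have [xA|xA] := boolP (x \in A); first by rewrite (setUidPr _) ?sub1set.
have [T sT eT] := rank_munion_witness M D (x |: A).
have [S sS eS] := rank_munion_witness N D A.
have xT : x \in T.
  apply: contraT => xT.
  have : #|(x |: A) :\: T| = #|A :\: T|.+1.
    have -> : (x |: A) :\: T = x |: (A :\: T).
      by apply/setP => z; rewrite !inE; case: (eqVneq z x) => //= ->; rewrite xT.
    by rewrite cardsU1 inE (negbTE xA) andbF.
  have := rank_munion_le M D A T; rewrite -eM eT => le e.
  by move: le; rewrite e addnS ltnn.
have h := rank_munion_le N D (x |: A) (S :|: T).
have h1 := quotient_rank q (subsetUl S T).
have h2 := rank_submod M S T; have h3 := rank_submod D S T.
have h4 := rank_munion_le M D A (S :&: T).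
have h0 := rankS (munion N D) (subsetUr [set x] A).
have eD (Z : {set E}) : x \in Z -> (x |: A) :\: Z = A :\: Z.
  by move=> xZ; apply/setP => z; rewrite !inE; case: (eqVneq z x) => //= ->; rewrite xZ.
rewrite eD // in eT; rewrite eD ?inE ?xT ?orbT // in h.
have := cardsUI (A :\: S) (A :\: T); rewrite -setDIr -setDUr.
move: eM eT eS h h0 h1 h2 h3 h4; clear; lia.
Qed.

End Union.

Section Meet.
Variable E : finType.
Implicit Types (M N D : matroid E) (X : {set E}).

(* Dual to matroid union: the bases are the inclusion-minimal
   intersections of bases (not common independent sets) *)
Definition meet_bases M N : {set {set E}} :=
  [set X | minset (fun X => X \in [set B :&: B' | B in bases M, B' in bases N]) X].

Lemma meet_basesE M N :
  meet_bases M N = bases (mdual (munion (mdual M) (mdual N))).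
Proof.
apply/setP => X; rewrite bases_mdual !inE maxminset setCK; apply: minset_eq => Y.
rewrite /=; apply/imset2P/imset2P => -[B B' Bin B'in e].
  exists (~: B) (~: B'); rewrite ?bases_mdual ?setCK //.
  by rewrite e setCI.
rewrite !bases_mdual in Bin B'in.
by exists (~: B) (~: B') => //; rewrite -setCU -e setCK.
Qed.

Lemma meet_basis_axiom M N : basis_axiom (meet_bases M N).
Proof. by rewrite meet_basesE; case: (mdual _). Qed.

Definition mmeet M N : matroid E := Matroid (meet_basis_axiom M N).

Lemma mmeetE M N : mmeet M N = mdual (munion (mdual M) (mdual N)).
Proof. by apply: val_inj; rewrite /= meet_basesE. Qed.

Lemma quotient_mmeet N M D : quotient N M -> quotient (mmeet N D) (mmeet M D).
Proof.
by move=> q; rewrite !mmeetE; apply/quotient_mdual/quotient_munion/quotient_mdual.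
Qed.

End Meet.

(* Disjoint unions of ground sets are sum types, so a restriction is taken along
   an injection f : F -> E identifying F with a subset of E: its bases are the
   maximal traces on F of bases of M, i.e. mrestr injf M is the deletion of
   E minus f(F) from M. When f is bijective it is a mere relabelling. *)
Section Restriction.
Variables (E F : finType) (f : F -> E) (injf : injective f).
Implicit Types (M N : matroid E) (A X : {set F}).

Definition restr_bases M : {set {set F}} :=
  [set X | maxset (fun X => X \in [set f @^-1: B | B : {set E} in bases M]) X].

Let P M X := indep M (f @: X).

Let restr_basesE M : restr_bases M = [set X | maxset (P M) X].
Proof.
apply/setP => X; rewrite !inE maxset_downclosure; apply: maxset_eq => Y.
apply/exists_inP/exists_inP => [[_ /imsetP [B Bin ->] sY]|[B Bin sY]].
  by exists B => //; rewrite sub_imset_pre.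
by exists (f @^-1: B); [apply: imset_f | rewrite -sub_imset_pre].
Qed.

Lemma restr_basis_axiom M : basis_axiom (restr_bases M).
Proof.
rewrite restr_basesE; apply: indep_system_basis_axiom.
- by rewrite /P imset0 indep0.
- by move=> I J sIJ; apply: indepS; apply: imsetS.
- move=> I J iI iJ; rewrite -(card_imset I injf) -(card_imset J injf) => lt.
  have [z] := indep_aug iI iJ lt; rewrite inE => /andP [zI /imsetP [y yJ ez]].
  move: zI; rewrite ez mem_imset // => yI iy; exists y; first by rewrite inE yI.
  by rewrite /P imsetU1.
Qed.

Definition mrestr M : matroid F := Matroid (restr_basis_axiom M).

Lemma indep_mrestr M X : indep (mrestr M) X = indep M (f @: X).
Proof.
apply: (indep_maxset (P := P M)); last exact: restr_basesE.
by move=> I J sIJ; apply: indepS; apply: imsetS.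
Qed.

Lemma rank_mrestr M A : rank (mrestr M) A = rank M (f @: A).
Proof.
apply/eqP; rewrite eqn_leq; apply/andP; split.
  have [I [iI sI <-]] := rank_witness (mrestr M) A.
  by rewrite -(card_imset I injf); apply: rank_ge; rewrite -?indep_mrestr ?imsetS.
have [I [iI sI <-]] := rank_witness M (f @: A).
have e : I = f @: (A :&: f @^-1: I).
  apply/setP => z; apply/idP/imsetP => [zI|[y]].
    have /imsetP [y yA zy] := subsetP sI _ zI.
    by exists y => //; rewrite !inE yA -zy.
  by rewrite !inE => /andP [_ yI] ->.
rewrite e card_imset //; apply: rank_ge (subsetIl _ _).
by rewrite indep_mrestr -e.
Qed.

Lemma quotient_mrestr N M : quotient N M -> quotient (mrestr N) (mrestr M).
Proof.
by move=> /quotientP q; apply/quotientP => A x; rewrite !rank_mrestr imsetU1; apply: q.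
Qed.

End Restriction.

Section DirectSum.
Variables E F : finType.
Implicit Types (M : matroid E) (N : matroid F) (X : {set (E + F)%type}).

Definition dsum_bases M N : {set {set (E + F)%type}} :=
  [set X : {set (E + F)%type} |
     (inl @^-1: X \in bases M) && (inr @^-1: X \in bases N)].

Let join (A : {set E}) (B : {set F}) : {set (E + F)%type} :=
  [set z | match z with inl x => x \in A | inr y => y \in B end].

Let joinl A B : inl @^-1: (join A B) = A.
Proof. by apply/setP => x; rewrite !inE. Qed.

Let joinr A B : inr @^-1: (join A B) = B.
Proof. by apply/setP => x; rewrite !inE. Qed.

Lemma dsum_basis_axiom M N : basis_axiom (dsum_bases M N).
Proof.
apply/basis_axiomP; split.
  have [B1 ?] := ex_basis M; have [B2 ?] := ex_basis N.
  by exists (join B1 B2); rewrite inE joinl joinr; apply/andP.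
move=> X Y [x|x]; rewrite !inE => /andP [X1 X2] /andP [Y1 Y2] xX xY.
  have [||y [yY yX Zin]] := basis_exchange X1 Y1 (x := x); rewrite ?inE //.
  rewrite !inE in yY yX; exists (inl y); split => //; rewrite inE; apply/andP; split.
    suff -> : inl @^-1: (inl y |: X :\ inl x) = y |: (inl @^-1: X) :\ x by [].
    by apply/setP => z; rewrite !inE.
  suff -> : inr @^-1: (inl y |: X :\ inl x) = inr @^-1: X by [].
  by apply/setP => z; rewrite !inE.
have [||y [yY yX Zin]] := basis_exchange X2 Y2 (x := x); rewrite ?inE //.
rewrite !inE in yY yX; exists (inr y); split => //; rewrite inE; apply/andP; split.
  suff -> : inl @^-1: (inr y |: X :\ inr x) = inl @^-1: X by [].
  by apply/setP => z; rewrite !inE.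
suff -> : inr @^-1: (inr y |: X :\ inr x) = y |: (inr @^-1: X) :\ x by [].
by apply/setP => z; rewrite !inE.
Qed.

Definition mdsum M N : matroid (E + F)%type := Matroid (dsum_basis_axiom M N).

Lemma card_sum_set X : #|X| = #|inl @^-1: X| + #|inr @^-1: X|.
Proof.
rewrite -!sum1_card big_sumType /=.
by congr (_ + _); apply: eq_bigl => z; rewrite inE.
Qed.

Lemma rank_mdsum M N X :
  rank (mdsum M N) X = rank M (inl @^-1: X) + rank N (inr @^-1: X).
Proof.
apply/eqP; rewrite eqn_leq; apply/andP; split.
  have [B Bin ->] := rank_max_witness (mdsum M N) X.
  move: Bin; rewrite inE => /andP [B1 B2].
  by rewrite card_sum_set !preimsetI leq_add // rank_max.
have [B1 B1in ->] := rank_max_witness M (inl @^-1: X).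
have [B2 B2in ->] := rank_max_witness N (inr @^-1: X).
have Bin : join B1 B2 \in bases (mdsum M N).
  by rewrite inE joinl joinr; apply/andP.
by have := rank_max X Bin; rewrite card_sum_set !preimsetI joinl joinr.
Qed.

Lemma quotient_mdsum M' M N : quotient M' M -> quotient (mdsum M' N) (mdsum M N).
Proof.
move=> /quotientP q; apply/quotientP => X [x|x]; rewrite !rank_mdsum.
  have -> : inl @^-1: (inl x |: X) = x |: inl @^-1: X.
    by apply/setP => z; rewrite !inE.
  have -> : inr @^-1: (inl x |: X) = inr @^-1: X.
    by apply/setP => z; rewrite !inE.
  by move=> /addIn /q ->.
have -> : inl @^-1: (inr x |: X) = inl @^-1: X.
  by apply/setP => z; rewrite !inE.
by move=> /addnI ->.
Qed.

End DirectSum.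

Lemma boolean_basis_axiom (E : finType) : basis_axiom [set [set: E]].
Proof.
apply/basis_axiomP; split; first by exists setT; rewrite inE.
by move=> B1 B2 x _; rewrite inE => /eqP ->; rewrite inE.
Qed.

Definition mboolean (E : finType) : matroid E := Matroid (boolean_basis_axiom E).

Fact matroid_display : Order.disp_t. Proof. by []. Qed.

Section Poset.
Variable E : finType.
Implicit Types M N : matroid E.

Lemma quotient_refl : reflexive (@quotient E).
Proof. by move=> M; apply/forallP => F; apply: implybb. Qed.

Lemma quotient_trans : transitive (@quotient E).
Proof.
move=> M N K /forallP q1 /forallP q2; apply/forallP => F.
by apply/implyP => /(implyP (q1 F)) /(implyP (q2 F)).
Qed.

Lemma quotient_anti : antisymmetric (@quotient E).
Proof.
move=> M N /andP [q1 q2]; apply: rank_ext_eq => A.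
have := quotient_rank q1 (sub0set A); have := quotient_rank q2 (sub0set A).
by rewrite !rank0; lia.
Qed.

(* The poset category Mat(E): N <= M iff N is a quotient of M. Functors between
   such categories are the order morphisms {omorphism matroid E -> matroid F}. *)
HB.instance Definition _ := Order.Le_isPOrder.Build matroid_display (matroid E)
  quotient_refl quotient_anti quotient_trans.

End Poset.

Section Correspondence.
Variables F1 F2 : finType.

(* Restricting along inr is deleting F1 *)
Definition mcorr (D : matroid (F1 + F2)%type) (M : matroid F1) : matroid F2 :=
  mrestr inr_inj (mmeet (mdsum M (mboolean F2)) D).

Lemma mcorr_homo D : {homo mcorr D : N M / (N <= M)%O}.
Proof. by move=> N M q; apply/quotient_mrestr/quotient_mmeet/quotient_mdsum. Qed.

HB.instance Definition _ D :=
  Order.isOrderMorphism.Build _ _ _ _ (mcorr D) (mcorr_homo D).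

End Correspondence.

Section Composite.
Variables E1 E2 E3 : finType.

Definition sum_assoc (z : E1 + (E2 + E3)) : (E1 + E2) + E3 :=
  match z with
  | inl x => inl (inl x)
  | inr (inl y) => inl (inr y)
  | inr (inr t) => inr t
  end.

Lemma sum_assoc_inj : injective sum_assoc.
Proof. by move=> [x|[y|t]] [x'|[y'|t']] // [->]. Qed.

Definition sum_outer (z : E1 + E3) : E1 + (E2 + E3) :=
  match z with inl x => inl x | inr t => inr (inr t) end.

Lemma sum_outer_inj : injective sum_outer.
Proof. by move=> [x|t] [x'|t'] // [->]. Qed.

(* Restricting along sum_assoc transports C1 (+) B_{E3} to the ground set of
   B_{E1} (+) C2; restricting along sum_outer deletes E2. *)
Definition mcomposite (C1 : matroid (E1 + E2)%type) (C2 : matroid (E2 + E3)%type)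
    : matroid (E1 + E3)%type :=
  mrestr sum_outer_inj
    (mmeet (mrestr sum_assoc_inj (mdsum C1 (mboolean E3)))
           (mdsum (mboolean E1) C2)).

End Composite.

(* Main.v *)
Require Import Defs.
From mathcomp Require Import all_boot all_order.
From mathcomp Require Import zify.
From Stdlib Require Import FunctionalExtensionality.

(** The idea is that a matroid correspondence acts on rank functions as a matrix
    acts on vectors over the (min, +) semiring, and that the matroid C of the
    theorem is the product matrix.

    In detail, the rank function of the meet of M and N is
      r(A) = min_S (r_M(S) + r_N(S) + |E \ S| + |A \ S|) - constant,
    by the rank formula for the matroid union and duality ([rank_min_mmeet]).
    A Boolean summand contributes only cardinalities, and it can be eliminated
    from the minimum.  This gives, up to additive constants
    and with S + T for the disjoint union of S and T,
      r_{D_* M}(X)      = min_{S1, S2} (r_M(S1) + |F1 \ S1|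
                            + r_D(S1 + S2) + |X \ S2|),
      r_C(X1 + X3)      = min_{T1, T2, T3} (r_C1(T1 + T2) + |E2 \ T2|
                            + r_C2(T2 + T3) + |X1 \ T1| + |X3 \ T3|)
    ([rank_min_mcorr], [rank_min_mcomposite]).  Substituting the first formula
    into itself describes C2_* (C1_* M), and substituting the second into the
    first describes C_* M.  Each then has repeated indices Y and Z that belong
    to the same ground set E and are coupled by |Y \ Z|.  Replacing both by
    Y :&: Z does not increase the sum: ranks are monotone, |E \ Y| + |Y \ Z| is
    |E \ (Y :&: Z)|, and |X \ (Y :&: Z)| <= |X \ Y| + |Y \ Z|.  Hence both minima
    equal the minimum over S1, S2, S3 of
      r_M(S1) + |E1 \ S1| + r_C1(S1 + S2) + |E2 \ S2| + r_C2(S2 + S3)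
        + |X \ S3|
    ([rank_min_mcorr_comp], [rank_min_mcorr_mcomposite]).
    The additive constants need not be tracked, because every rank function
    vanishes on the empty set ([rank_min_inj]). *)

Set Implicit Arguments.
Unset Strict Implicit.
Unset Printing Implicit Defensive.

(** * Rank functions as minima *)

(** The constant is written as a difference of two naturals, since it may have
    either sign; the index type is arbitrary so that minima can be nested. *)
Definition rank_min (E : finType) (M : matroid E) (I : Type)
    (F : {set E} -> I -> nat) : Prop :=
  exists a b, (forall A i, rank M A + a <= F A i + b) /\
              (forall A, exists i, rank M A + a = F A i + b).

Section RankMin.
Variable E : finType.
Implicit Types (M N : matroid E) (A : {set E}).

(** Two rank functions that differ by a constant agree at the empty set, so the
    constant is zero. *)
Lemma rank_min_inj M N (I : Type) (F : {set E} -> I -> nat) :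
  rank_min M F -> rank_min N F -> M = N.
Proof.
move=> [a [b [leM eM]]] [c [d [leN eN]]].
have same A : rank M A + a + d = rank N A + c + b.
  have [i ei] := eM A; have [j ej] := eN A.
  have := leM A j; have := leN A i; lia.
apply: rank_ext_eq => A.
have := same A; have := same set0; rewrite !rank0; lia.
Qed.

(** Change of the index set of a minimum. *)
Lemma rank_min_reindex M (I J : Type) (F : {set E} -> I -> nat)
    (G : {set E} -> J -> nat) (c d : nat) :
  rank_min M F ->
  (forall A j, exists i, F A i + c <= G A j + d) ->
  (forall A i, exists j, G A j + d <= F A i + c) -> rank_min M G.
Proof.
move=> [a [b [le ex]]] FG GF; exists (a + c), (b + d); split => [A j|A].
  have [i] := FG A j; have := le A i; lia.
have [i ei] := ex A; have [j lej] := GF A i; exists j.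
have [k] := FG A j; have := le A k; lia.
Qed.

(** Substitution of one minimum into another. *)
Lemma rank_min_subst (E' : finType) (K : matroid E') M (I J : Type)
    (F : {set E} -> I -> nat) (G : {set E'} -> J -> nat)
    (g : I -> {set E'}) (h : {set E} -> I -> nat) :
  (forall A i, F A i = rank K (g i) + h A i) ->
  rank_min M F -> rank_min K G ->
  rank_min M (fun A (ij : I * J) => G (g ij.1) ij.2 + h A ij.1).
Proof.
move=> eF [a [b [leM exM]]] [c [d [leK exK]]].
exists (a + c), (b + d); split => [A [i j]|A] /=.
  have := leM A i; have := leK (g i) j; rewrite eF; lia.
have [i ei] := exM A; have [j ej] := exK (g i); exists (i, j) => /=.
by move: ei; rewrite eF; lia.
Qed.

Lemma rank_mboolean A : rank (mboolean E) A = #|A|.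
Proof.
by apply/eqP; rewrite -indepE; apply/exists_inP; exists setT; rewrite ?inE ?subsetT.
Qed.

(** Dual to the rank formula r(A) = min_T (r_M(T) + r_N(T) + |A \ T|) of the
    matroid union, with S the complement of T. *)
Lemma rank_min_mmeet M N :
  rank_min (mmeet M N)
    (fun A S => rank M S + rank N S + #|~: S| + #|A :\: S|).
Proof.
rewrite mmeetE; set U := munion _ _.
have cost A S : #|A| + #|~: S| + #|~: A :\: ~: S| = #|E| + #|A :\: S|.
  have -> : ~: A :\: ~: S = S :\: A by rewrite !setDE setCK setIC.
  have := cardsID A S; have := cardsID S A; have := cardsC S.
  rewrite [A :&: S]setIC; lia.
exists (rank U setT + rank M setT + rank N setT), #|E|; split => [A S|A].
  have := rank_munion_le (mdual M) (mdual N) (~: A) (~: S); rewrite -/U.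
  have := rank_mdual U A; have := rank_mdual M (~: S); have := rank_mdual N (~: S).
  rewrite setCK; have := cost A S; lia.
have [T _] := rank_munion_witness (mdual M) (mdual N) (~: A); rewrite -/U => eT.
exists (~: T); have := cost A (~: T); rewrite !setCK.
have := rank_mdual U A; have := rank_mdual M T; have := rank_mdual N T; lia.
Qed.

End RankMin.

(** * Subsets of a disjoint union *)

Section SumSet.
Variables E F : finType.
Implicit Types (A : {set E}) (B : {set F}) (X : {set (E + F)%type}).

Definition sumset A B : {set (E + F)%type} :=
  [set z | match z with inl x => x \in A | inr y => y \in B end].

Lemma sumsetl A B : inl @^-1: sumset A B = A.
Proof. by apply/setP => x; rewrite !inE. Qed.

Lemma sumsetr A B : inr @^-1: sumset A B = B.
Proof. by apply/setP => x; rewrite !inE. Qed.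

Lemma sumset_split X : exists A B, X = sumset A B.
Proof.
by exists (inl @^-1: X), (inr @^-1: X); apply/setP => -[x|y]; rewrite !inE.
Qed.

Lemma card_sumset A B : #|sumset A B| = #|A| + #|B|.
Proof. by rewrite card_sum_set sumsetl sumsetr. Qed.

Lemma setC_sumset A B : ~: sumset A B = sumset (~: A) (~: B).
Proof. by apply/setP => -[x|y]; rewrite !inE. Qed.

Lemma setD_sumset A A' B B' :
  sumset A B :\: sumset A' B' = sumset (A :\: A') (B :\: B').
Proof. by apply/setP => -[x|y]; rewrite !inE. Qed.

Lemma imset_inr B : inr @: B = sumset set0 B.
Proof.
apply/setP => -[x|y]; rewrite !inE; first by apply/imsetP => -[].
by rewrite mem_imset //; apply: inr_inj.
Qed.

Lemma rank_mdsum_sumset (M : matroid E) (N : matroid F) A B :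
  rank (mdsum M N) (sumset A B) = rank M A + rank N B.
Proof. by rewrite rank_mdsum sumsetl sumsetr. Qed.

Lemma rankS_sumset (M : matroid (E + F)%type) A A' B B' :
  A \subset A' -> B \subset B' -> rank M (sumset A B) <= rank M (sumset A' B').
Proof.
by move=> sA sB; apply: rankS; apply/subsetP => -[x|y]; rewrite !inE;
  apply: subsetP.
Qed.

End SumSet.

(** This equality and the next inequality allow two copies of an index of
    minimisation to be replaced by their intersection. *)
Lemma cards_setC_merge (E : finType) (A B : {set E}) :
  #|~: (A :&: B)| = #|~: A| + #|A :\: B|.
Proof.
have := cardsID B A; have := cardsC A; have := cardsC (A :&: B); lia.
Qed.

Lemma leq_cards_setD_trans (E : finType) (A B C : {set E}) :
  #|A :\: (B :&: C)| <= #|A :\: B| + #|B :\: C|.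
Proof.
apply: leq_trans (leq_card_setU _ _); apply/subset_leq_card/subsetP => x.
by rewrite !inE; case: (x \in A) => //=; case: (x \in B); case: (x \in C).
Qed.

(** * Correspondences as (min, +) matrices *)

(** The Boolean matroid on F2 contributes |S2| to the rank and |F2 \ S2| is
    part of the formula for the meet; they add up to the constant |F2|. *)
Lemma rank_min_mcorr (F1 F2 : finType) (D : matroid (F1 + F2)%type)
    (M : matroid F1) :
  rank_min (mcorr D M)
    (fun X (S : {set F1} * {set F2}) =>
       rank M S.1 + #|~: S.1| + rank D (sumset S.1 S.2) + #|X :\: S.2|).
Proof.
have [a [b [le ex]]] := rank_min_mmeet (mdsum M (mboolean F2)) D.
have cost (X S2 : {set F2}) S1 : let S := sumset S1 S2 in
    rank (mdsum M (mboolean F2)) S + rank D S + #|~: S| + #|inr @: X :\: S| =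
    rank M S1 + #|~: S1| + rank D S + #|X :\: S2| + #|F2|.
  rewrite /= rank_mdsum_sumset rank_mboolean imset_inr setD_sumset setC_sumset.
  rewrite !card_sumset set0D cards0 -(cardsC S2); lia.
exists a, (b + #|F2|); split => [X [S1 S2]|X] /=.
  by rewrite rank_mrestr addnCA [leqRHS]addnC -cost; apply: le.
have [S] := ex (inr @: X); have [S1 [S2 ->]] := sumset_split S.
by rewrite cost => eS; exists (S1, S2); rewrite rank_mrestr eS /= -addnA (addnC b).
Qed.

Section Composite.
Variables (E1 E2 E3 : finType).
Variables (C1 : matroid (E1 + E2)%type) (C2 : matroid (E2 + E3)%type).

(** As in [rank_min_mcorr], the two Boolean summands complete |E1 \ T1| and
    |E3 \ T3| to constants, and only |E2 \ T2| remains. *)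
Lemma rank_min_mcomposite :
  rank_min (mcomposite C1 C2)
    (fun X (T : {set E1} * {set E2} * {set E3}) =>
       rank C1 (sumset T.1.1 T.1.2) + rank C2 (sumset T.1.2 T.2) + #|~: T.1.2|
         + #|inl @^-1: X :\: T.1.1| + #|inr @^-1: X :\: T.2|).
Proof.
pose A := mrestr (@sum_assoc_inj E1 E2 E3) (mdsum C1 (mboolean E3)).
pose B := mdsum (mboolean E1) C2.
have [a [b [le ex]]] := rank_min_mmeet A B.
have eA T1 T2 T3 : rank A (sumset T1 (sumset T2 T3)) =
    rank C1 (sumset T1 T2) + #|T3|.
  rewrite rank_mrestr -[#|T3|]rank_mboolean -rank_mdsum_sumset.
  congr (rank _ _); apply/setP => z.
  (* sum_assoc is onto: z is the image of its reassociation *)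
  suff [y ->] : exists y, z = sum_assoc y.
    rewrite mem_imset; last exact: sum_assoc_inj.
    by case: y => [x|[y|t]]; rewrite !inE /= ?inE.
  case: z => [[x|y]|t]; first by exists (inl x).
    by exists (inr (inl y)).
  by exists (inr (inr t)).
have eX (X1 : {set E1}) (X3 : {set E3}) :
    @sum_outer E1 E2 E3 @: sumset X1 X3 = sumset X1 (sumset set0 X3).
  apply/setP => -[x|[y|t]]; rewrite !inE /= ?inE.
  - rewrite -[inl x]/(@sum_outer E1 E2 E3 (inl x)) mem_imset ?inE //.
    exact: sum_outer_inj.
  - by apply/imsetP => -[[]].
  - rewrite -[inr (inr t)]/(@sum_outer E1 E2 E3 (inr t)) mem_imset ?inE //.
    exact: sum_outer_inj.
have cost (X : {set (E1 + E3)%type}) T1 T2 T3 :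
    let S := sumset T1 (sumset T2 T3) in
    rank A S + rank B S + #|~: S| + #|@sum_outer E1 E2 E3 @: X :\: S| =
    rank C1 (sumset T1 T2) + rank C2 (sumset T2 T3) + #|~: T2|
      + #|inl @^-1: X :\: T1| + #|inr @^-1: X :\: T3| + (#|E1| + #|E3|).
  have [X1 [X3 ->]] := sumset_split X.
  rewrite /= sumsetl sumsetr eA /B rank_mdsum_sumset rank_mboolean eX.
  rewrite !setD_sumset !setC_sumset !card_sumset set0D cards0.
  rewrite -(cardsC T1) -(cardsC T3); lia.
exists a, (b + (#|E1| + #|E3|)); split => [X [[T1 T2] T3]|X] /=.
  by rewrite rank_mrestr addnCA [leqRHS]addnC -cost; apply: le.
have [S] := ex (@sum_outer E1 E2 E3 @: X); have [T1 [S' ->]] := sumset_split S.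
have [T2 [T3 ->]] := sumset_split S'; rewrite cost => eS.
by exists (T1, T2, T3); rewrite rank_mrestr eS /= -addnA (addnC b).
Qed.

Variable M : matroid E1.

Let triple_cost (X : {set E3}) (T : {set E1} * {set E2} * {set E3}) :=
  rank M T.1.1 + #|~: T.1.1| + rank C1 (sumset T.1.1 T.1.2) + #|~: T.1.2|
    + rank C2 (sumset T.1.2 T.2) + #|X :\: T.2|.

(** The index S2 of the outer minimum and the index T2 of the inner one are
    coupled by |S2 \ T2|, the penalty of the inner correspondence. *)
Lemma rank_min_mcorr_comp : rank_min (mcorr C2 (mcorr C1 M)) triple_cost.
Proof.
have := rank_min_subst _ (rank_min_mcorr C2 (mcorr C1 M)) (rank_min_mcorr C1 M).
move=> /(_ fst (fun X S => #|~: S.1| + rank C2 (sumset S.1 S.2) + #|X :\: S.2|)).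
move=> /(_ (fun _ _ => _)) H.
apply: (rank_min_reindex (c := 0) (d := 0) (H _)) => [X S|X|X].
- by rewrite !addnA.
- move=> [[T1 T2] T3]; exists ((T2, T3), (T1, T2)) => /=.
  rewrite /triple_cost /= setDv cards0; lia.
move=> [[S2 S3] [T1 T2]] /=; exists (T1, S2 :&: T2, S3).
rewrite /triple_cost /= cards_setC_merge.
have := rankS_sumset C1 (subxx T1) (subsetIr S2 T2).
have := rankS_sumset C2 (subsetIl S2 T2) (subxx S3); lia.
Qed.

(** The index pairs S1, T1 and S3, T3 are coupled by the two penalties of the
    composite matroid. *)
Lemma rank_min_mcorr_mcomposite :
  rank_min (mcorr (mcomposite C1 C2) M) triple_cost.
Proof.
have := rank_min_subst _ (rank_min_mcorr (mcomposite C1 C2) M)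
  rank_min_mcomposite.
move=> /(_ (fun S => sumset S.1 S.2)
           (fun X S => rank M S.1 + #|~: S.1| + #|X :\: S.2|)) H.
apply: (rank_min_reindex (c := 0) (d := 0) (H _)) => [X S|X|X].
- lia.
- move=> [[T1 T2] T3]; exists ((T1, T3), (T1, T2, T3)) => /=.
  rewrite /triple_cost /= sumsetl sumsetr !setDv !cards0; lia.
move=> [[S1 S3] [[T1 T2] T3]] /=; exists (S1 :&: T1, T2, S3 :&: T3).
rewrite /triple_cost /= sumsetl sumsetr cards_setC_merge.
have := leq_cards_setD_trans X S3 T3; have := rankS M (subsetIl S1 T1).
have := rankS_sumset C1 (subsetIr S1 T1) (subxx T2).
have := rankS_sumset C2 (subxx T2) (subsetIr S3 T3); lia.
Qed.

Lemma mcorr_comp : mcorr C2 (mcorr C1 M) = mcorr (mcomposite C1 C2) M.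
Proof. exact: rank_min_inj rank_min_mcorr_comp rank_min_mcorr_mcomposite. Qed.

End Composite.

(** The monotonicity proof inside an order morphism is a family of boolean
    equalities, hence unique. *)
Lemma omorphism_eq d d' (T : Order.Preorder.type d) (T' : Order.Preorder.type d')
    (f g : {omorphism T -> T'}) : f =1 g -> f = g.
Proof.
case: f => f [[hf]]; case: g => g [[hg]] /= /functional_extensionality efg.
case: _ / efg hg => hg; do 3 congr (_ _).
do 3 apply: functional_extensionality_dep => ?; exact: bool_irrelevance.
Qed.

Theorem proposition2p6 (E1 E2 E3 : finType)
    (C1 : matroid (E1 + E2)%type) (C2 : matroid (E2 + E3)%type) :
  (mcorr C2 \o mcorr C1 : {omorphism matroid E1 -> matroid E3})
    = mcorr (mcomposite C1 C2) /\
  (exists D : matroid (E1 + E3)%type,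
    (mcorr C2 \o mcorr C1 : {omorphism matroid E1 -> matroid E3}) = mcorr D).
Proof.
have comp : (mcorr C2 \o mcorr C1 : {omorphism matroid E1 -> matroid E3})
    = mcorr (mcomposite C1 C2).
  by apply: omorphism_eq => M; apply: mcorr_comp.
by split=> //; exists (mcomposite C1 C2).
Qed.
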